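(* Let $g\in\mathcal{G}$. Assume that $Y$ is finite. Then $Bf=g$ has a solution $f\in\mathcal{F}$ if, and only if, $\{(\partial^\circ g)^{-1}(y)\}_{y\in Y}$ is a covering of $X$.
   Context: Setting. $\overline{\mathbb{R}}=\mathbb{R}\cup\{\pm\infty\}$. $X,Y$ are nonempty Hausdorff topological spaces, $\mathcal{F}=\mathrm{lsc}(Y,\overline{\mathbb{R}})$ is the set of lower semicontinuous functions $Y\to\overline{\mathbb{R}}$ (all functions when $Y$ is finite), $\mathcal{G}=\overline{\mathbb{R}}^X$ is the set of all functions $X\to\overline{\mathbb{R}}$, both with the pointwise order. $(B,B^\circ)$, $B:\mathcal{F}\to\mathcal{G}$, $B^\circ:\mathcal{G}\to\mathcal{F}$, is a dual Galois connection: $g\geq Bf\iff f\geq B^\circ g$ for all $f\in\mathcal{F},g\in\mathcal{G}$. Its kernels are the (unique) maps $b:X\times Y\times\overline{\mathbb{R}}\to\overline{\mathbb{R}}$, $b^\circ:Y\times X\times\overline{\mathbb{R}}\to\overline{\mathbb{R}}$ such that for all $(x,y)$, $(b(x,y,\cdot),b^\circ(y,x,\cdot))$ is a dual Galois connection between $\overline{\mathbb{R}}$ and $\overline{\mathbb{R}}$ (i.e. $t\geq b(x,y,s)\iff s\geq b^\circ(y,x,t)$), $b^\circ(\cdot,x,t)\in\mathcal{F}$ for all $x,t$, and $Bf(x)=\sup_{y\in Y}b(x,y,f(y))$, $B^\circ g(y)=\sup_{x\in X}b^\circ(y,x,g(x))$. Standing assumptions. There is a subset $\mathcal{S}\subset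 X\times Y$ such that: (A1) $\mathcal{S}_x=\{y\in Y\mid(x,y)\in\mathcal{S}\}\neq\emptyset$ for all $x\in X$; (A2) $\mathcal{S}^y=\{x\in X\mid(x,y)\in\mathcal{S}\}\neq\emptyset$ for all $y\in Y$; (A3) $b(x,y,\cdot)$ is a bijection $\overline{\mathbb{R}}\to\overline{\mathbb{R}}$ for all $(x,y)\in\mathcal{S}$; (A4) $b(x,y,\cdot)\equiv-\infty$ for $(x,y)\in(X\times Y)\setminus\mathcal{S}$. Subdifferential of $g\in\mathcal{G}$ at $x\in X$: $\partial^\circ g(x)=\{y\in Y\mid(x,y)\in\mathcal{S},\ b^\circ(y,x',g(x'))\leq b^\circ(y,x,g(x))\ \forall x'\in X\}$, and $(\partial^\circ g)^{-1}(y)=\{x\in X\mid y\in\partial^\circ g(x)\}$. A family of subsets of $X$ is a covering of $X'\subset X$ if its union contains $X'$. *)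

(* Defs.v *)
From HB Require Import structures.
From mathcomp Require Import all_boot all_order all_algebra.
From mathcomp Require Import all_classical all_reals.
From mathcomp Require Import ereal topology normedtype.

Set Implicit Arguments.
Unset Strict Implicit.
Unset Printing Implicit Defensive.

Import Order.TTheory.
Import numFieldNormedType.Exports.

Local Open Scope classical_set_scope.
Local Open Scope ereal_scope.

(* Values may be infinite: [lower_semicontinuous] only tests real levels, which
   is equivalent to testing all levels in \bar R. *)
Definition lsc (R : realType) (Y : topologicalType) : Type :=
  set_type [set f : Y -> \bar R | lower_semicontinuous f].

Definition lsc_val (R : realType) (Y : topologicalType) (f : lsc R Y) :
  Y -> \bar R := set_val f.
Coercion lsc_val : lsc >-> Funclass.

(* The order on [lsc R Y] is inherited from the pointwise order that the library
   puts on [Y -> \bar R]. *)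
HB.instance Definition _ (R : realType) (Y : topologicalType) :=
  SubChoice.copy (lsc R Y)
    (set_type [set f : Y -> \bar R | lower_semicontinuous f]).
HB.instance Definition _ (R : realType) (Y : topologicalType) :=
  [SubChoice_isSubPOrder of lsc R Y by <: with FunOrder.fun_display].

Lemma lsc_leP (R : realType) (Y : topologicalType) (f g : lsc R Y) :
  reflect (forall y, f y <= g y) (f <= g)%O.
Proof. by exact: lefP. Qed.

Section DualGalois.
Context {dA dC : Order.disp_t} {A : porderType dA} {C : porderType dC}.

Definition dual_galois_connection (B : A -> C) (Bo : C -> A) : Prop :=
  forall f g, (B f <= g)%O <-> (Bo g <= f)%O.

End DualGalois.

Section Kernels.
Context {R : realType} {X Y : topologicalType}.
Implicit Types (B : lsc R Y -> (X -> \bar R)) (Bo : (X -> \bar R) -> lsc R Y).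
Implicit Types (b : X -> Y -> \bar R -> \bar R).
Implicit Types (bo : Y -> X -> \bar R -> \bar R).
Implicit Types (S : set (X * Y)) (g : X -> \bar R).

Record galois_kernels B Bo b bo : Prop := GaloisKernels {
  kernels_galois : forall x y, dual_galois_connection (b x y) (bo y x) ;
  kernels_lsc : forall x t, lower_semicontinuous (fun y => bo y x t) ;
  kernels_sup : forall f x, B f x = ereal_sup [set b x y (f y) | y in [set: Y]] ;
  kernels_dual_sup : forall g y,
    Bo g y = ereal_sup [set bo y x (g x) | x in [set: X]] }.

Record kernel_support S b : Prop := KernelSupport {
  support_xsection : forall x, xsection S x !=set0 ;
  support_ysection : forall y, ysection S y !=set0 ;
  support_bij : forall x y, S (x, y) -> bijective (b x y) ;
  support_out : forall x y, ~ S (x, y) -> forall s, b x y s = -oo }.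

Definition subdiff S bo g (x : X) : set Y :=
  [set y | S (x, y) /\ forall x', bo y x' (g x') <= bo y x (g x)].

Definition subdiff_inv S bo g (y : Y) : set X :=
  [set x | subdiff S bo g x y].

End Kernels.

(* Main.v *)
(** A Galois pair [(b x y, bo y x)] restores every value in the range of the
    other map, so the two are inverse to each other when [b x y] is bijective.
    If [B f = g], finiteness of [Y] makes the supremum defining [B f x] attained
    at some [y], which can be taken with [(x, y)] in [S]; inverting [b x y] gives
    [f y = bo y x (g x)], and [B f <= g] says that this value dominates all
    [bo y x' (g x')], so [y] is a subgradient of [g] at [x]. Conversely, at a
    subgradient [y] of [g] at [x] the supremum [Bo g y] is [bo y x (g x)], whence
    [B (Bo g) x >= b x y (bo y x (g x)) = g x]. *)
Require Import Defs.
From mathcomp Require Import all_boot all_order all_algebra.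
From mathcomp Require Import all_classical all_reals.
From mathcomp Require Import ereal topology normedtype.

Local Open Scope classical_set_scope.

Import Order.TTheory.

Section DualGaloisTheory.
Context {dA dC : Order.disp_t} {A : porderType dA} {C : porderType dC}.
Variables (B : A -> C) (Bo : C -> A).
Hypothesis B_galois : dual_galois_connection B Bo.

Lemma dual_galois_le (g : C) : (B (Bo g) <= g)%O.
Proof. exact/B_galois. Qed.

Lemma dual_galois_co_le (f : A) : (Bo (B f) <= f)%O.
Proof. exact/B_galois. Qed.

Lemma dual_galois_anti (f f' : A) : (f <= f')%O -> (B f' <= B f)%O.
Proof. by move=> ff'; apply/B_galois/(le_trans (dual_galois_co_le f)). Qed.

Lemma dual_galoisK (f : A) : B (Bo (B f)) = B f.
Proof.
by apply/le_anti; rewrite dual_galois_le dual_galois_anti// dual_galois_co_le.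
Qed.

Lemma dual_galois_bijK : bijective B -> cancel B Bo.
Proof. by move=> /bij_inj B_inj f; apply/B_inj/dual_galoisK. Qed.

Lemma dual_galois_co_bijK : bijective B -> cancel Bo B.
Proof. by move=> [B' _ B'K] g; rewrite -(B'K g) dual_galoisK. Qed.

End DualGaloisTheory.

(** Since the order is total, a nonempty finite list has a greatest element, and a greatest element
    is the supremum. *)
Lemma finite_ereal_sup_in (R : realType) (A : set (\bar R)) :
  finite_set A -> A !=set0 -> A (ereal_sup A).
Proof.
move=> /finite_seqP[s ->] [c0 sc0].
suff [m sm m_ub] : exists2 m, m \in s & forall c, c \in s -> (c <= m)%O.
  suff -> : ereal_sup [set` s] = m by [].
  apply/le_anti/andP; split; first by apply: ge_ereal_sup => c; exact: m_ub.
  exact: ereal_sup_ubound.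
elim: s c0 sc0 => //= a s IHs _ _; case: s IHs => [_|c1 s IHs].
  by exists a => [|c]; rewrite inE // => /eqP ->.
have [m sm m_ub] := IHs c1 (mem_head c1 s).
case: (leP a m) => [am|/ltW ma].
  by exists m => [|c]; rewrite in_cons ?sm ?orbT// => /predU1P[->//|/m_ub].
exists a => [|c]; first exact: mem_head.
by rewrite in_cons => /predU1P[->//|/m_ub /le_trans]; exact.
Qed.

Theorem corollary3p7 (R : realType) (X Y : topologicalType)
    (X_neq0 : [set: X] !=set0) (Y_neq0 : [set: Y] !=set0)
    (X_hausdorff : hausdorff_space X) (Y_hausdorff : hausdorff_space Y)
    (B : lsc R Y -> (X -> \bar R)) (Bo : (X -> \bar R) -> lsc R Y)
    (B_galois : dual_galois_connection B Bo)
    (b : X -> Y -> \bar R -> \bar R) (bo : Y -> X -> \bar R -> \bar R)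
    (b_kernels : galois_kernels B Bo b bo)
    (S : set (X * Y)) (S_support : kernel_support S b)
    (g : X -> \bar R) (Y_finite : finite_set [set: Y]) :
  (exists f : lsc R Y, B f = g) <->
  [set: X] `<=` cover [set: Y] (subdiff_inv S bo g).
Proof.
case: b_kernels => b_galois _ BE BoE.
case: S_support => Sx_neq0 _ b_bij b_out.
have b_le (f : lsc R Y) x y : (b x y (f y) <= B f x)%O.
  by rewrite BE; apply: ereal_sup_ubound; exists y.
split=> [[f Bfg] x _|g_cover].
  have [y Sxy byE] : exists2 y, S (x, y) & b x y (f y) = g x.
    have [y0 Sxy0] := Sx_neq0 x; rewrite /xsection /= inE in Sxy0.
    (* If [g x] is -oo, a maximizer may lie outside [S], but every term of the supremum is -oo, so
       [y0] serves. Otherwise a maximizer must lie in [S], as [b] is -oo elsewhere. *)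
    have [gxNy|gx_neqNy] := eqVneq (g x) -oo%E.
      exists y0 => //; apply/eqP; rewrite gxNy -leeNy_eq -gxNy -Bfg.
      exact: b_le.
    have [z _ bzE] : [set b x y (f y) | y in [set: Y]] (B f x).
      rewrite BE; apply: finite_ereal_sup_in; first exact: finite_image.
      by have [z _] := Y_neq0; exists (b x z (f z)), z.
    exists z; last by rewrite bzE Bfg.
    apply: contrapT => /b_out bzNy.
    by move: gx_neqNy; rewrite -Bfg -bzE bzNy eqxx.
  exists y => //; split=> // x'.
  rewrite -byE (dual_galois_bijK _ _ (b_galois x y) (b_bij x y Sxy)).
  (* The bound is now [f y], and the Galois pair at [(x', y)] turns the goal into
     [b x' y (f y) <= g x']. *)
  by apply/b_galois; rewrite -Bfg b_le.
(* The Galois connection alone gives [B (Bo g) <= g]; the covering yields the reverse inequality. *)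
exists (Bo g); apply/le_anti; rewrite (dual_galois_le _ _ B_galois) /=.
apply/lefP => x; have [y _ [Sxy bo_max]] := g_cover x I.
rewrite -{1}(dual_galois_co_bijK _ _ (b_galois x y) (b_bij x y Sxy) (g x)).
suff <- : Bo g y = bo y x (g x) by exact: b_le.
rewrite BoE; apply/le_anti/andP; split; first by apply: ge_ereal_sup => _ [x' _ <-].
by apply: ereal_sup_ubound; exists x.
Qed.
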